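(* Let $\mathcal{T}=(V,E)$ be a countably infinite rooted and leafless directed tree, $\boldsymbol{\beta}=\{\beta_v\}_{v\in V}\subseteq(0,\infty)$ and $\boldsymbol{\lambda}=\{\lambda_v\}_{v\in V^\circ}\subseteq(0,\infty)$. If $\sum_{v\in\mathrm{Chi}(u)}\lambda_v=1$ for every $u\in V$ and $S_{\boldsymbol\lambda}\in\mathbf{B}(\ell^2(\boldsymbol\beta))$, where $S_{\boldsymbol\lambda}$ is the weighted shift on $\mathcal{T}_{\boldsymbol\beta}$, then $$\mathsf{V}_w(M_{\hat\varphi}f)=\varphi(w)\,\mathsf{V}_w(f),\qquad f\in\ell^2(\boldsymbol\beta),\ \hat\varphi\in\mathcal{M}(\mathcal{T}_{\boldsymbol\beta},\boldsymbol\lambda),\ w\in\operatorname{int}(\mathrm{bpe}(\mathcal{T}_{\boldsymbol\beta})).$$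
   Context: $\mathbb{N}_0=\{0,1,2,\dots\}$; $\mathbf{B}(\mathcal{H})$ is the algebra of bounded operators on $\mathcal{H}$; $\operatorname{int}$ denotes the interior in $\mathbb{C}$. A rooted directed tree $\mathcal{T}=(V,E)$ is a connected directed graph without circuits having a unique vertex $\mathrm{root}$ without a parent and such that every $v\in V^\circ:=V\setminus\{\mathrm{root}\}$ has a unique parent $\mathrm{par}(v)$, i.e. a unique $u$ with $(u,v)\in E$. $\mathrm{par}^k$ is the $k$-fold composition of $\mathrm{par}$ ($\mathrm{par}^0$ the identity); $\mathrm{Chi}(u)=\{v\in V:(u,v)\in E\}$; leafless means every vertex has at least one child; $|v|$ is the unique $k\in\mathbb{N}_0$ with $\mathrm{par}^k(v)=\mathrm{root}$. For $v$ a descendant of $u$, i.e. $\mathrm{par}^n(v)=u$ for some $n\in\mathbb{N}_0$, put $\lambda_{u|v}=\prod_{j=0}^{n-1}\lambda_{\mathrm{par}^j(v)}$ (equal to $1$ if $u=v$). $\ell^2(\boldsymbol{\beta})$ is the Hilbert space of all $f:V\to\mathbb{C}$ with $\|f\|_{\boldsymbol\beta}^2=\sum_{v\in V}|f(v)|^2\beta_v<\infty$, with $\langle f,g\rangle_{\boldsymbol\beta}=\sum_{v\in V} f(v)\overline{g(v)}\beta_v$. $\mathcal{T}_{\boldsymbol\beta}$ denotes the pair $(\mathcal{T},\boldsymbol\beta)$. The weighted shift $S_{\boldsymbol{\lambda}}$ on $\mathcal{T}_{\boldsymbol\beta}$ is given by $(S_{\boldsymbol\lambda}f)(v)=\lambda_v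 f(\mathrm{par}(v))$ for $v\in V^\circ$, $(S_{\boldsymbol\lambda}f)(\mathrm{root})=0$, on the domain of all $f\in\ell^2(\boldsymbol\beta)$ for which the resulting function lies in $\ell^2(\boldsymbol\beta)$. For $\hat\varphi:\mathbb{N}_0\to\mathbb{C}$ let $(\Gamma_{\hat\varphi}f)(v)=\sum_{k=0}^{|v|}\lambda_{\mathrm{par}^k(v)|v}\,\hat\varphi(k)\,f(\mathrm{par}^k(v))$ for $f\in\mathbb{C}^V$, $v\in V$. The multiplication operator $M_{\hat\varphi}$ in $\ell^2(\boldsymbol\beta)$ has domain $\{f\in\ell^2(\boldsymbol\beta):\Gamma_{\hat\varphi}f\in\ell^2(\boldsymbol\beta)\}$ and acts by $M_{\hat\varphi}f=\Gamma_{\hat\varphi}f$. $\mathcal{M}(\mathcal{T}_{\boldsymbol\beta},\boldsymbol\lambda)$ is the set of all $\hat\varphi:\mathbb{N}_0\to\mathbb{C}$ for which the domain of $M_{\hat\varphi}$ is all of $\ell^2(\boldsymbol\beta)$ (then $M_{\hat\varphi}$ is bounded). The set of bounded point evaluations is $\mathrm{bpe}(\mathcal{T}_{\boldsymbol\beta})=\{w\in\mathbb{C}:\sum_{v\in V}\beta_v^{-1}|w|^{2|v|}<\infty\}$ (with $0^0=1$). For $w\in\mathrm{bpe}(\mathcal{T}_{\boldsymbol\beta})$, $\mathsf{V}_w:\ell^2(\boldsymbol\beta)\to\mathbb{C}$ is the continuous linear functional $\mathsf{V}_w(f)=\sum_{v\in V}f(v)w^{|v|}$ (the series converges absolutely).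 For $\hat\varphi\in\mathcal{M}(\mathcal{T}_{\boldsymbol\beta},\boldsymbol\lambda)$ and $w\in\operatorname{int}(\mathrm{bpe}(\mathcal{T}_{\boldsymbol\beta}))$ one sets $\varphi(w)=\sum_{n\in\mathbb{N}_0}\hat\varphi(n)w^n$; under the hypotheses of the claim this series converges absolutely. *)

(* Defs.v *)
Set Warnings "-notation-overridden,-ambiguous-paths".

From HB Require Import structures.
From mathcomp Require Import all_boot all_order all_algebra.
From mathcomp Require Import complex.
From mathcomp Require Import all_classical all_reals all_analysis.
From mathcomp.analysis.showcase Require Import summability.

Set Implicit Arguments.
Unset Strict Implicit.
Unset Printing Implicit Defensive.

Import Order.TTheory GRing.Theory Num.Theory.
Import numFieldNormedType.Exports.

Local Open Scope classical_set_scope.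
Local Open Scope complex_scope.
Local Open Scope ring_scope.

(* The complex numbers over R, with the topology and the one-dimensional
   normed-space structure given by the modulus. *)
Notation Cplx R := (R[i]^o) (only parsing).

Record rooted_tree (V : choiceType) := RootedTree {
  edge : rel V;
  tree_root : V;
  edge_irr : irreflexive edge;
  tree_connected : forall u v,
    exists2 p : seq V, path [rel x y | edge x y || edge y x] u p & last u p = v;
  tree_no_circuit : forall c : seq V, (1 < size c)%N -> ~~ ucycleb edge c;
  root_no_parent : forall u, ~~ edge u tree_root;
  unique_parent : forall v, v <> tree_root -> exists! u, edge u v
}.

Section Tree.
Context {V : choiceType} (T : rooted_tree V).

Definition Chi (u : V) : set V := [set v | edge T u v].

Definition leafless := forall u, Chi u !=set0.

(* The value [par (tree_root T) = tree_root T] is junk; the definitions below only use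
   the k-fold composition at v for k <= |v|. *)
Definition par (v : V) : V := xget (tree_root T) [set u | edge T u v].

(* The condition on [j] says that the k-fold composition of the partial
   function par is defined at v. *)
Definition depth (v : V) : nat :=
  xget 0%N [set k | iter k par v = tree_root T /\
                    forall j, (j < k)%N -> iter j par v <> tree_root T].

End Tree.

Section WeightedShift.
Context {R : realType} {V : choiceType} (T : rooted_tree V).
Variables (beta lambda : V -> R).
Implicit Types (f : V -> Cplx R) (phi : nat -> Cplx R) (w : Cplx R).

(* The squared norm, with value +oo outside l^2(beta). *)
Definition sqnorm f : \bar R :=
  \esum_(v in [set: V]) (Normc.normc (f v) ^+ 2 * beta v)%:E.

Definition l2 : set (V -> Cplx R) := [set f | (sqnorm f < +oo)%E].

Definition l2norm f : R := Num.sqrt (fine (sqnorm f)).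

(* A partially defined operator in l^2(beta); [op_app] is only meaningful on
   the domain. *)
Record operator := Operator {
  op_dom : set (V -> Cplx R);
  op_app :> (V -> Cplx R) -> (V -> Cplx R)
}.

(* Membership in B(l^2(beta)). *)
Definition in_B (A : operator) : Prop :=
  [/\ op_dom A = l2,
      forall f, l2 f -> l2 (A f),
      forall (a : Cplx R) f g, l2 f -> l2 g ->
        A (fun v => a * f v + g v) = (fun v => a * A f v + A g v) &
      exists c : R, forall f, l2 f -> l2norm (A f) <= c * l2norm f].

(* The value of [lambda] at the root is never used. *)
Definition shift f (v : V) : Cplx R :=
  if v == tree_root T then 0 else (lambda v)%:C * f (par T v).

Definition weighted_shift : operator :=
  Operator [set f | l2 f /\ l2 (shift f)] shift.

(* lambda_{par^n(v)|v}, for n <= |v|. *)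
Definition lambda_path (n : nat) (v : V) : R :=
  \prod_(j < n) lambda (iter j (par T) v).

Definition Gamma phi f (v : V) : Cplx R :=
  \sum_(k < (depth T v).+1)
     (lambda_path k v)%:C * phi k * f (iter k (par T) v).

Definition mul_op phi : operator :=
  Operator [set f | l2 f /\ l2 (Gamma phi f)] (Gamma phi).

Definition multipliers : set (nat -> Cplx R) :=
  [set phi | op_dom (mul_op phi) = l2].

Definition bpe : set (Cplx R) :=
  [set w | (\esum_(v in [set: V])
              ((beta v)^-1 * Normc.normc w ^+ (2 * depth T v))%:E < +oo)%E].

(* [sum] is the unconditional sum: the limit of the finite partial sums along
   the directed family of finite subsets of V. *)
Definition Vw w f : Cplx R := sum (fun v => f v * w ^+ depth T v).

Definition mul_symbol phi w : Cplx R := limn (series (fun n => phi n * w ^+ n)).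

End WeightedShift.

(* Main.v *)
Require Import Defs.
Set Warnings "-notation-overridden,-ambiguous-paths,-notation-incompatible-prefix".
From mathcomp Require Import all_boot all_order all_algebra.
From mathcomp Require Import complex finmap.
From mathcomp Require Import all_classical all_reals all_analysis.
From mathcomp.analysis.showcase Require Import summability.
From mathcomp Require Import ring lra.
Import Order.TTheory GRing.Theory Num.Theory.
Import numFieldNormedType.Exports.

(* Put a_k = phi(k) w^k, b_u = f(u) w^|u| and consider, on pairs (k, v) with
   k <= |v|, the family lambda_{par^k(v)|v} a_k b_{par^k(v)}.  Summed over k it
   gives (Gamma f)(v) w^|v|.  For fixed k and u the weights lambda_{u|v} with
   par^k(v) = u sum to 1, so summed along (k, v) |-> (k, par^k(v)) it gives
   a_k b_u, whose sum is phi(w) V_w(f).  The two sums agree as soon as the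
   family is absolutely summable, that is, as soon as a and b are.  For b this
   is Cauchy-Schwarz; for a, apply the same bound to the image under the
   multiplier of the indicator of the root, whose value at v is
   lambda_{root|v} phi(|v|). *)

Set Implicit Arguments.
Unset Strict Implicit.
Unset Printing Implicit Defensive.

Local Open Scope classical_set_scope.
Local Open Scope ring_scope.

(** * Unconditional sums in normed spaces *)

Section HasSum.
#[local] Existing Instance totally_filter.

Context {K : numFieldType} {E : normedModType K}.
Implicit Types I J : choiceType.

(** Stated as a relation because [sum] is a limit operator that has a value even for divergent
    families; [has_sum F s] also asserts unconditional convergence. *)
Definition has_sum {I} (F : I -> E) (s : E) : Prop :=
  partial_sum F @ totally --> s.

Lemma partial_sumE {I} (F : I -> E) :
  partial_sum F = (fun A : {fset I} => \sum_(i <- A) F i).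
Proof. by apply/funext => A; rewrite /partial_sum [RHS]big_seq_fsetE. Qed.

Lemma has_sum_sum {I} (F : I -> E) s : has_sum F s -> sum F = s.
Proof. by apply: (cvg_lim (@norm_hausdorff K E)); apply: totally_filter. Qed.

Lemma has_sum_unique {I} (F : I -> E) s t : has_sum F s -> has_sum F t -> s = t.
Proof. by move=> /has_sum_sum <- /has_sum_sum. Qed.

Lemma has_sumP {I} (F : I -> E) s : has_sum F s <->
  forall e : K, 0 < e -> exists A : {fset I}, forall B : {fset I},
    (A `<=` B)%fset -> `|s - \sum_(i <- B) F i| < e.
Proof.
rewrite /has_sum partial_sumE; split.
  by move=> /cvgrPdist_lt Fs e /Fs [A _ AF]; exists A => B; apply: AF.
by move=> Fs; apply/cvgrPdist_lt => e /Fs [A AF]; exists A.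
Qed.

Lemma has_sumD {I} (F G : I -> E) s t :
  has_sum F s -> has_sum G t -> has_sum (fun i => F i + G i) (s + t).
Proof.
rewrite /has_sum => Fs Gt.
rewrite (_ : partial_sum _ = partial_sum F + partial_sum G); first exact: cvgD.
by rewrite !partial_sumE; apply/funext => A; rewrite /= big_split.
Qed.

Lemma has_sumZ {I} (F : I -> E) s (c : K) :
  has_sum F s -> has_sum (fun i => c *: F i) (c *: s).
Proof.
rewrite /has_sum => Fs.
rewrite (_ : partial_sum _ = c \*: partial_sum F); first exact: cvgZr.
by rewrite !partial_sumE; apply/funext => A /=; rewrite /= scaler_sumr.
Qed.

Lemma has_sum_fset {I} (F : I -> E) (A : {fset I}) :
  (forall i, i \notin A -> F i = 0) -> has_sum F (\sum_(i <- A) F i).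
Proof.
move=> F0; apply/has_sumP => e e0; exists A => B AB.
by rewrite (big_fset_incl _ AB) ?subrr ?normr0// => i _; apply: F0.
Qed.

Lemma has_sum_sums {I J} (F : J -> I -> E) (G : J -> E) (B : seq J) :
  (forall j, has_sum (F j) (G j)) ->
  has_sum (fun i => \sum_(j <- B) F j i) (\sum_(j <- B) G j).
Proof.
move=> FG; elim: B => [|j B IH].
  rewrite big_nil; under eq_fun do rewrite big_nil.
  have := @has_sum_fset I (fun=> 0) fset0 (fun _ _ => erefl).
  by rewrite big1.
rewrite big_cons; under eq_fun do rewrite big_cons.
exact: has_sumD.
Qed.

(** A finite set [B] containing the image of [A] meets the range of [e] in the image of a finite [C]
    containing [A], and [G] vanishes on the rest of [B]. *)
Lemma has_sum_inj {I J} (e : I -> J) (F : I -> E) (G : J -> E) s :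
  injective e -> (forall i, G (e i) = F i) ->
  (forall j, (forall i, e i <> j) -> G j = 0) ->
  has_sum F s -> has_sum G s.
Proof.
move=> einj GF G0 /has_sumP Fs; apply/has_sumP => eps /Fs [A AF].
exists (e @` A)%fset => B AB.
have Bfin : finite_set (e @^-1` [set` B]).
  by apply: finite_preimage => [x y _ _ /einj //|]; apply: finite_fset.
pose C := fset_set (e @^-1` [set` B]).
have eC i : (i \in C) = (e i \in B) by rewrite in_fset_set// mem_setE.
have /AF : (A `<=` C)%fset.
  by apply/fsubsetP => i iA; rewrite eC (fsubsetP AB)// in_imfset.
suff -> : \sum_(i <- C) F i = \sum_(j <- B) G j by [].
transitivity (\sum_(j <- (e @` C)%fset) G j).
  by rewrite big_imfset /=; [apply: eq_bigr|move=> x y _ _ /einj].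
apply: big_fset_incl.
  by apply/fsubsetP => _ /imfsetP[i /= iC ->]; rewrite -eC.
move=> j jB jC; apply: G0 => i eij; move: jC.
by rewrite -eij in_imfset //= eC eij jB.
Qed.

Lemma sum_fiber {I J} (p : I -> J) (F : I -> E) (A : seq I) (B : {fset J}) :
  \sum_(j <- B) \sum_(i <- A) (if p i == j then F i else 0) =
  \sum_(i <- A | p i \in B) F i.
Proof.
rewrite exchange_big/= [RHS]big_mkcond/=; apply: eq_bigr => i _.
case: ifPn => [piB|piB]; last first.
  rewrite big_seq big1// => j jB; case: eqP => // pij.
  by rewrite pij jB in piB.
rewrite (big_fsetD1 (p i)) //= eqxx big_seq big1 ?addr0// => j.
by rewrite !inE eq_sym => /andP[/negbTE ->].
Qed.

(** Finitely many fibre sums are approximated at once by partial sums over one finite set, which can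
    be enlarged until it also approximates the total of [F]. *)
Lemma has_sum_fiber {I J} (p : I -> J) (F : I -> E) (G : J -> E) s :
  has_sum F s ->
  (forall j, has_sum (fun i => if p i == j then F i else 0) (G j)) ->
  has_sum G s.
Proof.
move=> /has_sumP Fs FG; apply/has_sumP => e e0.
have e20 : 0 < e / 2 by rewrite divr_gt0.
have [A0 A0F] := Fs _ e20.
exists (p @` A0)%fset => B AB.
(* One finite set serves all fibres over [B], since a finite sum of summable families is
   summable. *)
have /has_sumP/(_ _ e20) [A1 A1F] := has_sum_sums (B := enum_fset B) FG.
pose C := (A0 `|` A1)%fset.
have {A1F} := A1F C (fsubsetUr _ _).
rewrite exchange_big/= sum_fiber => CG.
(* The indices of [C] lying over [B] still include [A0], because [B] contains the image of [A0]. *)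
have CF : `|s - \sum_(i <- C | p i \in B) F i| < e / 2.
  rewrite big_fset_condE A0F//.
  apply/fsubsetP => i iA; rewrite !inE iA /=.
  by apply: (fsubsetP AB); rewrite in_imfset.
rewrite (splitr e) (le_lt_trans _ (ltrD CF CG))//.
by rewrite (distrC (\sum_(j <- B) G j)) ler_distD.
Qed.

End HasSum.

(** * Nonnegative real families *)

Section RealSums.
Context {R : realType}.
Implicit Types I J : choiceType.

(** For nonnegative families this amounts to summability with sum at most [M], without extended
    reals. *)
Definition sums_le {I} (a : I -> R) (M : R) : Prop :=
  forall A : {fset I}, \sum_(i <- A) a i <= M.

Lemma fsum_le_esum {I} (a : I -> R) (A : {fset I}) :
  ((\sum_(i <- A) a i)%:E <= \esum_(i in [set: I]) (a i)%:E)%E.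
Proof.
apply: esum_ge; exists [set` A]; first by split => //; apply: finite_fset.
by rewrite fsbig_finite; [rewrite set_fsetK sumEFin|apply: finite_fset].
Qed.

Lemma sum_le_subset {I} (a : I -> R) (A B : {fset I}) :
  (forall i, 0 <= a i) -> (A `<=` B)%fset ->
  \sum_(i <- A) a i <= \sum_(i <- B) a i.
Proof.
move=> a0 AB.
rewrite (_ : \sum_(i <- A) a i = \sum_(i <- A) (if i \in A then a i else 0)).
  rewrite (big_fset_incl _ AB) => [|i _ /negbTE -> //].
  by apply: ler_sum => i _; case: ifP.
by rewrite big_seq [RHS]big_seq; apply: eq_bigr => i ->.
Qed.

Lemma has_sum_sums_le {I} (a : I -> R^o) s :
  (forall i, 0 <= a i) -> has_sum a s -> sums_le a s.
Proof.
move=> a0 /has_sumP as_ A; apply/ler_addgt0Pr => e e0.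
have [B /(_ (A `|` B)%fset (fsubsetUr _ _))] := as_ _ e0.
rewrite distrC => /(le_lt_trans (ler_norm _)).
have := sum_le_subset a0 (fsubsetUl A B).
lra.
Qed.

(** A finite set nearly attaining the supremum stays near it when enlarged, by monotonicity. *)
Lemma esum_has_sum {I} (a : I -> R^o) s :
  (forall i, 0 <= a i) -> \esum_(i in [set: I]) (a i)%:E = s%:E -> has_sum a s.
Proof.
move=> a0 as_; apply/has_sumP => e e0.
have : \esum_(i in [set: I]) (a i)%:E \is a fin_num by rewrite as_.
move=> /(ub_ereal_sup_adherent e0)[_ [X [Xfin _] <-]].
rewrite [ereal_sup _]as_ fsbig_finite//= sumEFin -EFinB lte_fin => aX.
exists (fset_set X) => B XB.
have := fsum_le_esum a B; rewrite as_ lee_fin => aB.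
rewrite ger0_norm ?subr_ge0//.
have := sum_le_subset a0 XB.
lra.
Qed.

Lemma esum_lty {I} (a : I -> R) M :
  sums_le a M -> (\esum_(i in [set: I]) (a i)%:E < +oo)%E.
Proof.
move=> aM; rewrite (@le_lt_trans _ _ M%:E) ?ltry//.
apply: ge_ereal_sup => _ [X [Xfin _] <-].
by rewrite fsbig_finite//= sumEFin lee_fin.
Qed.

Lemma sums_le_has_sum {I} (a : I -> R^o) M :
  (forall i, 0 <= a i) -> sums_le a M -> exists s, has_sum a s.
Proof.
move=> a0 aM; exists (fine (\esum_(i in [set: I]) (a i)%:E)).
apply: esum_has_sum => //; rewrite fineK// ge0_fin_numE ?(esum_lty aM)//.
by apply: esum_ge0 => i _; rewrite lee_fin.
Qed.

Lemma sums_leW {I} (a b : I -> R) M :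
  (forall i, a i <= b i) -> sums_le b M -> sums_le a M.
Proof. by move=> ab bM A; rewrite (le_trans _ (bM A))// ler_sum. Qed.

Lemma sums_le_esum {I} (a : I -> R) : (forall i, 0 <= a i) ->
  (\esum_(i in [set: I]) (a i)%:E < +oo)%E ->
  sums_le a (fine (\esum_(i in [set: I]) (a i)%:E)).
Proof.
move=> a0 afin A; rewrite -lee_fin fineK ?fsum_le_esum// ge0_fin_numE//.
by apply: esum_ge0 => i _; rewrite lee_fin.
Qed.

Lemma sums_le_fiber {I J} (p : I -> J) (a : I -> R) (g : J -> R) M :
  (forall i, 0 <= a i) ->
  (forall j, sums_le (fun i => if p i == j then a i else 0) (g j)) ->
  sums_le g M -> sums_le a M.
Proof.
move=> a0 ag gM A; rewrite (le_trans _ (gM (p @` A)%fset))//.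
rewrite (le_trans _ (ler_sum _ (fun j _ => ag j A)))//.
rewrite (sum_fiber (E := R^o)) big_seq_cond [leRHS]big_seq_cond.
rewrite le_eqVlt; apply/orP; left; apply/eqP/eq_bigl => i /=.
by case: (boolP (i \in A)) => //= iA; rewrite in_imfset.
Qed.

(** Tonelli's theorem: the fibre sums bound the finite partial sums of [a] by [s], which gives
    summability, and [has_sum_fiber] then forces the total to be [s]. *)
Lemma has_sum_fiber_ge0 {I J} (p : I -> J) (a : I -> R^o) (g : J -> R^o) s :
  (forall i, 0 <= a i) -> (forall j, 0 <= g j) ->
  (forall j, has_sum (fun i => if p i == j then a i else 0) (g j)) ->
  has_sum g s -> has_sum a s.
Proof.
move=> a0 g0 ag gs.
have [|t at_] := @sums_le_has_sum _ a s a0.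
  apply: (sums_le_fiber (p := p) a0 _ (has_sum_sums_le g0 gs)) => j.
  by apply: has_sum_sums_le => // i; case: ifP.
by rewrite (has_sum_unique gs (has_sum_fiber at_ ag)).
Qed.

End RealSums.

(** * Absolutely summable complex families *)

Section ComplexSums.
Context {R : realType}.
Implicit Types I J : choiceType.

Lemma has_sum_real_complex {I} (a : I -> R^o) s :
  has_sum a s -> has_sum (fun i => (a i)%:C%C : Cplx R) s%:C%C.
Proof.
move=> /has_sumP as_; apply/has_sumP => e e0.
(* In the order of the complex numbers a positive [e] is real. *)
case: e e0 => x y; rewrite ltcE /= => /andP[/eqP -> x0].
have [A aA] := as_ _ x0. exists A => B /aA.
rewrite -(rmorph_sum (real_complex R)) -rmorphB.
by rewrite normc_def/= expr0n addr0 sqrtr_sqr ltcR.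
Qed.

(** Real and imaginary parts are split into positive and negative parts, each dominated by the
    modulus. *)
Lemma has_sum_complex {I} (F : I -> Cplx R) M :
  sums_le (fun i => Normc.normc (F i)) M -> exists s, has_sum F s.
Proof.
move=> FM.
have part (a : I -> R) : (forall i, `|a i| <= Normc.normc (F i)) ->
    exists s, has_sum (fun i => (a i)%:C%C : Cplx R) s.
  move=> aF.
  have [||p ps] := @sums_le_has_sum _ _ (fun i => Num.max (a i) 0) M.
  - by move=> i; rewrite le_max lexx orbT.
  - apply: sums_leW FM => i; rewrite ge_max (le_trans (ler_norm _) (aF i)) /=.
    exact: le_trans (aF i).
  have [||q qs] := @sums_le_has_sum _ _ (fun i => Num.max (- a i) 0) M.
  - by move=> i; rewrite le_max lexx orbT.
  - apply: sums_leW FM => i; rewrite ge_max.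
    rewrite (le_trans (ler_norm _)) ?normrN//=.
    exact: le_trans (aF i).
  exists (p - q)%:C%C; apply: has_sum_real_complex.
  have := has_sumD ps (has_sumZ (c := -1) qs).
  rewrite scaleN1r; congr (has_sum _ _); apply/funext => i.
  rewrite scaleN1r; have [a0|a0] := leP 0 (a i).
    by rewrite max_r ?oppr_le0// subr0.
  by rewrite max_l ?oppr_ge0 ?ltW// opprK add0r.
have [|r rs] := part (fun i => complex.Re (F i)).
  move=> i; case: (F i) => x y /=.
  by rewrite -sqrtr_sqr ler_wsqrtr// lerDl sqr_ge0.
have [|t ts] := part (fun i => complex.Im (F i)).
  move=> i; case: (F i) => x y /=.
  by rewrite -sqrtr_sqr ler_wsqrtr// lerDr sqr_ge0.
exists (r + 'i%C * t).
have := has_sumD rs (has_sumZ (c := 'i%C) ts).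
congr (has_sum _ _); apply/funext => i.
by rewrite [RHS]complexE.
Qed.

End ComplexSums.

(** * Ordered series and rows of product families *)

Lemma has_sum_series {K : numFieldType} {E : normedModType K} (a : nat -> E) s :
  has_sum a s -> series a @ \oo --> s.
Proof.
move=> /has_sumP as_; apply/cvgrPdist_lt => e /as_[A aA].
(* [series a n] sums the indices below [n], hence the successor in the bound. *)
exists (\max_(k <- A) k.+1)%N => // n /= An.
have /aA : (A `<=` fset_set `I_n)%fset.
  apply/fsubsetP => k kA; rewrite in_fset_set ?inE//=.
  exact: leq_trans (leq_bigmax_seq _ kA isT) An.
by rewrite -fsbig_finite// -fsbig_ord /series/= big_mkord.
Qed.

Lemma has_sum_pair_fiber {K : numFieldType} {E : normedModType K}
    {I J : choiceType} (a : I -> K) (b : J -> E) s (i : I) :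
  has_sum b s ->
  has_sum (fun x => if x.1 == i then a x.1 *: b x.2 else 0) (a i *: s).
Proof.
move=> bs.
apply: (has_sum_inj (e := fun j => (i, j)) _ _ _ (has_sumZ (c := a i) bs)).
- by move=> x y [].
- by move=> j; rewrite eqxx.
- by move=> [k j] /= ij; case: eqP => // ki; case: (ij j); rewrite ki.
Qed.

(** * The modulus of a complex number *)

Section Normc.
Context {R : rcfType}.
Implicit Types x : R[i].

Lemma normc_ge0 x : 0 <= Normc.normc x.
Proof. by case: x => a b; apply: sqrtr_ge0. Qed.

Lemma normcX x n : Normc.normc (x ^+ n) = Normc.normc x ^+ n.
Proof.
by elim: n => [|n IH]; rewrite ?Normc.normc1// !exprS Normc.normcM IH.
Qed.

Lemma normc_real (r : R) : Normc.normc r%:C%C = `|r|.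
Proof. by rewrite /= expr0n addr0 sqrtr_sqr. Qed.

End Normc.

(** * Parents and depth in the tree *)

Section Trees.
Context {V : choiceType} (T : rooted_tree V).
Implicit Types u v : V.

Lemma par_edge u v : edge T u v -> par T v = u.
Proof.
move=> uv; have vr : v <> tree_root T.
  by move=> vr; have := root_no_parent T u; rewrite -vr uv.
have [u' [_ u'P]] := unique_parent vr.
by apply: xget_unique => // y yv; rewrite -(u'P _ uv) (u'P _ yv).
Qed.

Lemma edge_par v : v <> tree_root T -> edge T (par T v) v.
Proof. by move=> vr; have [u [uv _]] := unique_parent vr; rewrite (par_edge uv). Qed.

(** Follow an undirected path from the root: a step to a child adds one iterate, a step to the
    parent removes one, and no edge enters the root. *)
Lemma iter_par_root v : exists k, iter k (par T) v = tree_root T.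
Proof.
have [p pp <-] := tree_connected T (tree_root T) v.
have reach u q : path [rel x y | edge T x y || edge T y x] u q ->
    (exists k, iter k (par T) u = tree_root T) ->
    exists k, iter k (par T) (last u q) = tree_root T; last first.
  by apply: reach pp _; exists 0%N.
elim: q u => [//|x q IH] u /= /andP[ux xq] [k uk].
apply: IH => //; case/orP: ux => [ux|xu].
  by exists k.+1; rewrite iterSr (par_edge ux).
case: k uk => [/= ur|k]; last by rewrite iterSr (par_edge xu); exists k.
by have := root_no_parent T x; rewrite -ur xu.
Qed.

(** Some iterate reaches the root, so a least one exists and the default value in [depth] is never
    taken. *)
Lemma depthP v : iter (depth T v) (par T) v = tree_root T /\
  forall j, (j < depth T v)%N -> iter j (par T) v <> tree_root T.
Proof.
have [k0 /eqP k0P] := iter_par_root v.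
have exk : exists k, iter k (par T) v == tree_root T by exists k0.
apply: (@xgetPex _ 0%N [set k | iter k (par T) v = tree_root T /\
  forall j, (j < k)%N -> iter j (par T) v <> tree_root T]).
have [m /eqP mr mmin] := ex_minnP exk.
by exists m; split=> // j jm /eqP/mmin; rewrite leqNgt jm.
Qed.

(** The bound on [k] matters: [par] sends the root to itself, so all later iterates are the root as
    well. *)
Lemma depth_eq v k : (k <= depth T v)%N ->
  (iter k (par T) v == tree_root T) = (depth T v == k).
Proof.
move=> kv; have [vr vmin] := depthP v.
apply/eqP/eqP => [kr|<- //].
by apply/eqP; rewrite eqn_leq kv andbT leqNgt; apply/negP => /vmin.
Qed.

Lemma depth_root : depth T (tree_root T) = 0%N.
Proof. by apply/eqP; rewrite -depth_eq. Qed.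

Lemma depth_par v : v <> tree_root T -> depth T v = (depth T (par T v)).+1.
Proof.
move=> vr; have [pr pmin] := depthP (par T v).
apply/eqP; rewrite -depth_eq ?iterSr ?pr//.
(* Otherwise the iterates starting at the parent would reach the root before its depth. *)
rewrite ltnNge; apply/negP => dv; have [v0 _] := depthP v.
case E : (depth T v) dv v0 => [|d] //= dv.
by rewrite -iterS iterSr; apply: pmin.
Qed.

Lemma depth_iter v k : (k <= depth T v)%N ->
  depth T v = (k + depth T (iter k (par T) v))%N.
Proof.
elim: k => [//|k IH] kv; rewrite addSnnS {1}(IH (ltnW kv)) /= -depth_par//.
by apply/eqP; rewrite depth_eq ?(ltnW kv)// gtn_eqF.
Qed.

End Trees.

(** * Path weights as a probability on each generation of descendants *)

Section Kernel.
Context {R : realType} {V : choiceType} (T : rooted_tree V) (lambda : V -> R).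
Hypothesis lambda_gt0 : forall v, v <> tree_root T -> 0 < lambda v.
Hypothesis lambda_sum1 :
  forall u, (\esum_(v in Chi T u) (lambda v)%:E = 1)%E.

(** Extension by zero beyond the depth gives a family on all of [nat * V] and discards the pairs
    where the iterates of [par] are stuck at the root. *)
Definition kernel k v : R :=
  if (k <= depth T v)%N then lambda_path T lambda k v else 0.

Lemma kernel_ge0 k v : 0 <= kernel k v.
Proof.
rewrite /kernel; case: ifP => // kv; apply: prodr_ge0 => j _.
apply/ltW/lambda_gt0; have [_] := depthP T v; apply.
exact: leq_trans (ltn_ord j) kv.
Qed.

Lemma kernel0 v : kernel 0 v = 1.
Proof. by rewrite /kernel /lambda_path big_ord0. Qed.

Lemma kernelS_root k : kernel k.+1 (tree_root T) = 0.
Proof. by rewrite /kernel depth_root. Qed.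

Lemma kernelS k v :
  v <> tree_root T -> kernel k.+1 v = lambda v * kernel k (par T v).
Proof.
move=> vr; rewrite /kernel (depth_par vr) ltnS; case: ifP => _; last first.
  by rewrite mulr0.
rewrite /lambda_path big_ord_recl; congr (_ * _).
by apply: eq_bigr => j _; rewrite -iterSr.
Qed.

Lemma has_sum_lambda u :
  has_sum (fun v => if edge T u v then lambda v else 0 : R^o) (1 : R).
Proof.
apply: esum_has_sum => [v|].
  case: ifP => // uv; apply/ltW/lambda_gt0 => vr.
  by have := root_no_parent T u; rewrite -vr uv.
rewrite -(lambda_sum1 u) [RHS]esum_mkcond; apply: eq_esum => v _.
by rewrite [v \in _]asboolb; case: ifP.
Qed.

(** Induction on [k], grouping the vertices by parent: the children of [v'] carry total weight
    [kernel k v'], because their [lambda] sum to 1. *)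
Lemma has_sum_kernel k u :
  has_sum (fun v => if iter k (par T) v == u then kernel k v else 0 : R^o)
          (1 : R).
Proof.
elim: k => [|k IH].
  have := @has_sum_fset _ R^o _ (fun v => (v == u)%:R) [fset u]%fset.
  rewrite big_seq_fset1 eqxx.
  have -> : (fun v => if iter 0 (par T) v == u then kernel 0 v else 0) =
            (fun v => (v == u)%:R).
    by apply/funext => v; rewrite /= kernel0; case: eqP.
  by apply => v; rewrite inE => /negbTE ->.
apply: (has_sum_fiber_ge0 (p := par T) _ _ _ IH) => [v|v|v'].
- by case: ifP => // _; apply: kernel_ge0.
- by case: ifP => // _; apply: kernel_ge0.
have := has_sumZ (c := if iter k (par T) v' == u then kernel k v' else 0)
  (has_sum_lambda v').
rewrite [X in has_sum _ X]mulr1; congr (has_sum _ _); apply/funext => v.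
rewrite [LHS]mulrC iterSr; have [vr|vr] := pselect (v = tree_root T).
  (* The root is its own value under [par], but its weight is zero here. *)
  rewrite vr (negbTE (root_no_parent T v')) mul0r kernelS_root.
  by case: ifP => //; case: ifP.
case: ifP => [/par_edge vv'|vv'].
  by rewrite kernelS// vv' eqxx; case: ifP; rewrite ?mulr0.
by rewrite mul0r; case: eqP => // vp; rewrite -vp edge_par in vv'.
Qed.

(** The fibre over [(k, u)] lies in the slice with first coordinate [k], where [has_sum_kernel]
    applies. *)
Lemma has_sum_kernel_pair k u :
  has_sum (fun x : nat * V => if (x.1, iter x.1 (par T) x.2) == (k, u)
                              then kernel x.1 x.2 else 0 : R^o)
          (1 : R).
Proof.
apply: (has_sum_inj (e := fun v => (k, v)) _ _ _ (has_sum_kernel k u)).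
- by move=> x y [].
- by move=> v; rewrite xpair_eqE eqxx.
- move=> [j v] /= jv; case: eqP => // -[jk _].
  by case: (jv v); rewrite jk.
Qed.

End Kernel.

(** * Absolute summability for functions and multipliers *)

Section Multipliers.
Context {R : realType} {V : choiceType} (T : rooted_tree V).
Variables (beta lambda : V -> R).
Hypothesis beta_gt0 : forall v, 0 < beta v.
Hypothesis lambda_gt0 : forall v, v <> tree_root T -> 0 < lambda v.
Hypothesis lambda_sum1 :
  forall u, (\esum_(v in Chi T u) (lambda v)%:E = 1)%E.
Implicit Types (f : V -> Cplx R) (phi : nat -> Cplx R) (w : Cplx R).

(* Cauchy-Schwarz in the additive form [x y <= x^2 b + y^2 / b]. *)
Lemma l2_bpe_has_sum f w : l2 beta f -> bpe T beta w ->
  exists s, has_sum (fun v => Normc.normc (f v * w ^+ depth T v) : R^o) s.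
Proof.
move=> f2 wb.
have f0 v : 0 <= Normc.normc (f v) ^+ 2 * beta v.
  by rewrite mulr_ge0 ?sqr_ge0// ltW.
have w0 v : 0 <= (beta v)^-1 * Normc.normc w ^+ (2 * depth T v).
  by rewrite mulr_ge0 ?exprn_ge0 ?normc_ge0// invr_ge0 ltW.
have [M fM] : exists M, sums_le (fun v => Normc.normc (f v) ^+ 2 * beta v) M.
  by eexists; apply: sums_le_esum f2.
have [N wN] : exists N,
    sums_le (fun v => (beta v)^-1 * Normc.normc w ^+ (2 * depth T v)) N.
  by eexists; apply: sums_le_esum wb.
apply: (@sums_le_has_sum _ _ _ (M + N)) => [v|A]; first exact: normc_ge0.
apply: le_trans (lerD (fM A) (wN A)); rewrite -big_split/=.
apply: ler_sum => v _; rewrite Normc.normcM normcX mulnC exprM.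
set x := Normc.normc (f v); set y := _ ^+ depth T v.
have b0 := beta_gt0 v.
(* The difference is a completed square plus a nonnegative cross term, divided by [beta v]. *)
rewrite -subr_ge0 (_ : _ - _ =
  (beta v)^-1 * ((x * beta v - y) ^+ 2 + (x * beta v) * y)).
  have x0 : 0 <= x by exact: normc_ge0.
  have y0 : 0 <= y by rewrite exprn_ge0 ?normc_ge0.
  rewrite mulr_ge0 ?invr_ge0 ?(ltW b0)//.
  by rewrite addr_ge0 ?sqr_ge0// !mulr_ge0 ?(ltW b0).
by field; rewrite gt_eqF.
Qed.

Definition root_indicator (v : V) : Cplx R := (v == tree_root T)%:R.

Lemma l2_root_indicator : l2 beta root_indicator.
Proof.
apply: (@esum_lty _ _ _ (\sum_(v <- [fset tree_root T]%fset)
  (Normc.normc (root_indicator v) ^+ 2 * beta v))).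
apply: has_sum_sums_le => [v|]; first by rewrite mulr_ge0 ?sqr_ge0// ltW.
apply: (@has_sum_fset _ R^o) => v; rewrite inE /root_indicator => /negbTE ->.
by rewrite Normc.normc0 expr0n mul0r.
Qed.

(** Up to the depth of [v], an iterated parent is the root only at the last index, so one term
    survives. *)
Lemma Gamma_root_indicator phi v :
  Gamma T lambda phi root_indicator v =
  (lambda_path T lambda (depth T v) v)%:C%C * phi (depth T v).
Proof.
rewrite /Gamma big_ord_recr/= big1 ?add0r => [|k _]; last first.
  by rewrite /root_indicator depth_eq ?(ltnW (ltn_ord k))// gtn_eqF ?mulr0.
by rewrite /root_indicator depth_eq// eqxx mulr1.
Qed.

(** Group by depth the family that Cauchy-Schwarz makes summable for the image of [root_indicator]:
    generation [k] has total weight 1, hence contributes exactly the modulus of [phi k * w ^+ k]. *)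
Lemma multiplier_has_sum phi w :
  multipliers T beta lambda phi -> bpe T beta w ->
  exists s, has_sum (fun k => Normc.normc (phi k * w ^+ k) : R^o) s.
Proof.
move=> phiM wb.
have [_ G2] : op_dom (mul_op T beta lambda phi) root_indicator.
  by rewrite phiM; apply: l2_root_indicator.
have [s Gs] := l2_bpe_has_sum G2 wb.
exists s; apply: (has_sum_fiber (p := depth T) Gs) => k.
have := has_sumZ (c := Normc.normc (phi k * w ^+ k))
  (has_sum_kernel lambda_gt0 lambda_sum1 k (tree_root T)).
rewrite [X in has_sum _ X]mulr1; congr (has_sum _ _); apply/funext => v.
(* Beyond the depth of [v] the iterate is the root by default, but [kernel] vanishes. *)
rewrite [LHS]mulrC /kernel; case: (leqP k (depth T v)) => [kv|kv]; last first.
  by rewrite ltn_eqF// if_same mul0r.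
rewrite depth_eq//; case: eqP => [<-|_]; last by rewrite mul0r.
rewrite Gamma_root_indicator -mulrA [in RHS]Normc.normcM normc_real.
rewrite ger0_norm//; have := kernel_ge0 lambda_gt0 (depth T v) v.
by rewrite /kernel leqnn.
Qed.

End Multipliers.

(** * Summing the double family in two ways *)

Theorem theorem19 (R : realType) (V : choiceType) (T : rooted_tree V)
    (beta lambda : V -> R)
    (V_countable : countable [set: V]) (V_infinite : infinite_set [set: V])
    (T_leafless : leafless T)
    (beta_gt0 : forall v, 0 < beta v)
    (lambda_gt0 : forall v, v <> tree_root T -> 0 < lambda v)
    (lambda_sum1 : forall u, (\esum_(v in Chi T u) (lambda v)%:E = 1)%E)
    (shift_bounded : in_B beta (weighted_shift T beta lambda)) :
  forall (f : V -> Cplx R) (phi : nat -> Cplx R) (w : Cplx R),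
    l2 beta f -> multipliers T beta lambda phi -> interior (bpe T beta) w ->
    Vw T w (mul_op T beta lambda phi f) = mul_symbol phi w * Vw T w f.
Proof.
move=> f phi w f2 phiM /interior_subset wb.
pose a k : Cplx R := phi k * w ^+ k.
pose b v : Cplx R := f v * w ^+ depth T v.
have [na a_na] : exists s, has_sum (fun k => Normc.normc (a k) : R^o) s.
  exact: multiplier_has_sum phiM wb.
have [nb b_nb] : exists s, has_sum (fun v => Normc.normc (b v) : R^o) s.
  exact: l2_bpe_has_sum f2 wb.
have normc_has_sum (I : choiceType) (F : I -> Cplx R) s :
    has_sum (fun i => Normc.normc (F i) : R^o) s -> exists t, has_sum F t.
  move=> Fs; apply: (@has_sum_complex _ _ _ s).
  by apply: has_sum_sums_le Fs => i; apply: normc_ge0.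
have [A aA] := normc_has_sum _ _ _ a_na.
have [B bB] := normc_has_sum _ _ _ b_nb.
pose p (x : nat * V) := (x.1, iter x.1 (par T) x.2).
(* The double family, with zero at the pairs where [k] exceeds the depth of [v]. *)
pose F (x : nat * V) : Cplx R :=
  (a x.1 * b (p x).2) * (kernel T lambda x.1 x.2)%:C%C.
have kernel_p ku : has_sum
    (fun x => if p x == ku then kernel T lambda x.1 x.2 else 0 : R^o) (1 : R).
  by case: ku => k u; apply: has_sum_kernel_pair.
have nab : has_sum (fun ku => Normc.normc (a ku.1) * Normc.normc (b ku.2) : R^o)
    (na * nb).
  apply: (has_sum_fiber_ge0 (p := fst) (g := fun k => Normc.normc (a k) * nb)).
  - by move=> x; rewrite mulr_ge0 ?normc_ge0.
  - move=> k; rewrite mulr_ge0 ?normc_ge0//.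
    (* The empty partial sum shows that [nb] is nonnegative. *)
    have := has_sum_sums_le (fun v => normc_ge0 (b v)) b_nb fset0.
    by rewrite big_nil.
  - by move=> k; exact: (@has_sum_pair_fiber R R^o _ _ (fun k => Normc.normc (a k)) _ _ k b_nb).
  - have := has_sumZ (c := nb) a_na.
    rewrite [X in has_sum _ X]mulrC; congr (has_sum _ _).
    by apply/funext => k; apply: mulrC.
(* Along [p] the moduli of [F] sum to the summable product family [nab], so Tonelli applies. *)
have [s Fs] : exists s, has_sum F s.
  apply: normc_has_sum; apply: (has_sum_fiber_ge0 (p := p) _ _ _ nab).
  - by move=> x; apply: normc_ge0.
  - by move=> x; rewrite mulr_ge0 ?normc_ge0.
  move=> ku; have := has_sumZ
    (c := Normc.normc (a ku.1) * Normc.normc (b ku.2)) (kernel_p ku).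
  rewrite [X in has_sum _ X]mulr1; congr (has_sum _ _); apply/funext => x.
  case: eqP => [<-|_]; last exact: mulr0.
  rewrite /F !Normc.normcM normc_real ger0_norm//.
  exact: kernel_ge0.
have s_Gamma : has_sum (fun v => Gamma T lambda phi f v * w ^+ depth T v) s.
  apply: (has_sum_fiber (p := snd) Fs) => v.
  (* The fibre over [v] is effectively finite: [kernel] vanishes outside [X]. *)
  pose X := [fset (k, v) | k in fset_set `I_(depth T v).+1]%fset.
  have -> : Gamma T lambda phi f v * w ^+ depth T v =
      \sum_(x <- X) (if x.2 == v then F x else 0).
    rewrite big_imfset/=; last by move=> ? ? _ _ [].
    rewrite -fsbig_finite// -fsbig_ord /Gamma mulr_suml; apply: eq_bigr => k _.
    have kv : (k <= depth T v)%N by rewrite -ltnS.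
    (* The power of [w] splits along the path: one factor goes to [a], the other to [b]. *)
    have -> : w ^+ depth T v = w ^+ k * w ^+ depth T (iter k (par T) v).
      by rewrite -exprD -depth_iter.
    rewrite eqxx /F /kernel kv /a /b /=.
    by ring.
  apply: has_sum_fset => -[k v'] /= kvX; case: eqP => // v'v.
  rewrite /F /kernel /= v'v; case: ifP => [kv|_]; last exact: mulr0.
  case/negP: kvX; rewrite v'v; apply/imfsetP; exists k => //=.
  by rewrite in_fset_set// inE/= ltnS.
(* Grouping along [p] instead: each fibre has total weight 1, which leaves the product family with
   the same total [s]. *)
have s_ab : has_sum (fun ku : nat * V => a ku.1 * b ku.2 : Cplx R) s.
  apply: (has_sum_fiber (p := p) Fs) => ku.
  have := has_sumZ (c := a ku.1 * b ku.2) (has_sum_real_complex (kernel_p ku)).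
  rewrite [X in has_sum _ X]mulr1; congr (has_sum _ _); apply/funext => x.
  by case: eqP => [<- //|_]; apply: mulr0.
have s_aB : has_sum (fun k => a k * B : Cplx R) s.
  apply: (has_sum_fiber (p := fst) s_ab) => k.
  exact: (@has_sum_pair_fiber R[i] (Cplx R) _ _ a _ _ k bB).
(* The row sums [a k * B] have total [s]; by scaling they also have total [A * B], so the two
   agree. *)
have AB_aB : has_sum (fun k => a k * B : Cplx R) (A * B).
  have := has_sumZ (c := B) aA.
  rewrite [X in has_sum _ X]mulrC; congr (has_sum _ _).
  by apply/funext => k; apply: mulrC.
have phiA : mul_symbol phi w = A.
  exact: (cvg_lim (@norm_hausdorff _ (Cplx R)) (has_sum_series aA)).
rewrite [LHS](has_sum_sum s_Gamma) (has_sum_unique s_aB AB_aB) phiA.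
by rewrite [Vw T w f](has_sum_sum bB).
Qed.
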